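(* Let $R$ be a finite commutative chain ring with residue field of size $q=p^r$ ($p$ prime) and nilpotency index $s>1$. Let $\mathcal{C}\subseteq R^n$ be a linear code with dual $\mathcal{C}^\perp$. Then for every homogeneous weight-unit decomposition $\rho\in\mathbb{D}^{\mathsf{hom}}_n$, $$\mathcal{D}^{\mathsf{hom}}_\rho(\mathcal{C}^\perp)=\frac1{|\mathcal{C}|}\sum_{\pi\in\mathbb{D}^{\mathsf{hom}}_n}K^{\mathsf{hom}}_\pi(\rho)\,\mathcal{D}^{\mathsf{hom}}_\pi(\mathcal{C}),$$ where $$K^{\mathsf{hom}}_\pi(\rho)=\sum_{\substack{t\in\mathrm{Comp}^{\mathsf{hom}}_\pi(\rho)\\ t_{UU}=t_{UR}=t_{RU}=0}}\left(\prod_{i\in\{Z,U,S,R\}}\binom{\pi_i}{t_{iZ},t_{iU},t_{iS},t_{iR}}\right)\kappa^{\mathsf{hom}}(t)$$ and $$\kappa^{\mathsf{hom}}(t)=(-1)^{t_{US}}(-q^{s-1})^{t_{SU}}\bigl(q^{s-1}(q-1)\bigr)^{t_{ZU}}(q^{s-1}-q)^{t_{ZR}+t_{SR}}(q-1)^{t_{ZS}+t_{SS}+t_{RS}}(-q)^{t_{RR}}.$$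
   Context: A linear code $\mathcal{C}\subseteq R^n$ is an $R$-submodule; its dual is $\mathcal{C}^\perp=\{x\in R^n:\sum_i x_ic_i=0\ \forall c\in\mathcal{C}\}$. Let $\langle\gamma\rangle$ be the maximal ideal of $R$ and $s$ the nilpotency index of $\gamma$. The ring $R$ is partitioned into four sets, indexed by the letters $Z,U,S,R$: $I_Z=\{0\}$, $I_U=R^\times$, $I_S=\langle\gamma^{s-1}\rangle\setminus\{0\}$, $I_R=\langle\gamma\rangle\setminus\langle\gamma^{s-1}\rangle$ (empty if $s=2$). For $x\in R^n$ the homogeneous weight-unit decomposition is $\pi(x)=(\pi_Z,\pi_U,\pi_S,\pi_R)$ with $\pi_i=|\{k:x_k\in I_i\}|$. $\mathbb{D}^{\mathsf{hom}}_n$ is the set of all such decompositions of elements of $R^n$, and $\mathcal{D}^{\mathsf{hom}}_\pi(\mathcal{C})=|\{c\in\mathcal{C}:\pi(c)=\pi\}|$. For $\pi,\rho\in\mathbb{D}^{\mathsf{hom}}_n$, $\mathrm{Comp}^{\mathsf{hom}}_\pi(\rho)$ is the set of arrays $t=(t_{ij})_{i,j\in\{Z,U,S,R\}}$ of nonnegative integers with $\sum_jt_{ij}=\pi_i$ for all $i$ and $\sum_it_{ij}=\rho_j$ for all $j$. Multinomial coefficients are used, and $0^0=1$. *)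

(* Defs.v *)
From HB Require Import structures.
From mathcomp Require Import all_boot all_order all_algebra.

Set Implicit Arguments.
Unset Strict Implicit.
Unset Printing Implicit Defensive.

Import GRing.Theory.
Local Open Scope ring_scope.

Definition residue_ring (R : finComNzRingType) (m : idealr R) : Type :=
  {ideal_quot m}.

HB.instance Definition _ (R : finComNzRingType) (m : idealr R) :=
  [Finite of residue_ring m by <:%/].

(* [idealr R] is the type of proper ideals; the unit ideal is trivially
   comparable to every ideal, so it may be left out. *)
Definition chain_ring (R : comNzRingType) : Prop :=
  forall I J : idealr R, {subset I <= J} \/ {subset J <= I}.

Definition maximal_ideal (R : comNzRingType) (m : idealr R) : Prop :=
  forall J : idealr R, {subset m <= J} -> {subset J <= m}.

Definition principal (R : finComNzRingType) (x : R) : {set R} :=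
  [set a * x | a : R].

Definition nilpotency_index (R : comNzRingType) (x : R) (s : nat) : Prop :=
  x ^+ s = 0 /\ (forall k : nat, (k < s)%N -> x ^+ k <> 0).

Definition linear_code (R : finComNzRingType) (n : nat)
    (C : {set 'rV[R]_n}) : Prop := GRing.submod_closed C.

Definition dual (R : finComNzRingType) (n : nat) (C : {set 'rV[R]_n}) :
    {set 'rV[R]_n} :=
  [set x : 'rV[R]_n | [forall c in C, \sum_(i < n) x 0 i * c 0 i == 0]].

Inductive letter := LZ | LU | LS | LR.

Definition nat_of_letter (l : letter) : nat :=
  match l with LZ => 0 | LU => 1 | LS => 2 | LR => 3 end.

Definition letter_of_nat (k : nat) : letter :=
  match k with 0 => LZ | 1 => LU | 2 => LS | _ => LR end.

Lemma nat_of_letterK : cancel nat_of_letter letter_of_nat.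
Proof. by case. Qed.

HB.instance Definition _ := Countable.copy letter (can_type nat_of_letterK).

Lemma letter_enumP : Finite.axiom [:: LZ; LU; LS; LR].
Proof. by case. Qed.

HB.instance Definition _ := isFinite.Build letter letter_enumP.

(* [g] stands for a generator of the maximal ideal, [s] for its nilpotency
   index. *)
Definition letter_class (R : finComUnitRingType) (g : R) (s : nat)
    (l : letter) : {set R} :=
  match l with
  | LZ => [set 0]
  | LU => [set x | x \is a GRing.unit]
  | LS => principal (g ^+ s.-1) :\ 0
  | LR => principal g :\: principal (g ^+ s.-1)
  end.

Lemma card_class_subproof (n : nat) (P : pred 'I_n) :
  (#|[set k | P k]| < n.+1)%N.
Proof. by rewrite ltnS -[X in (_ <= X)%N]card_ord max_card. Qed.

(* The counts are at most [n]; bounding them makes decompositions a finite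
   type, over which one can sum. *)
Notation decomposition n := {ffun letter -> 'I_n.+1}.

Definition hwu (R : finComUnitRingType) (g : R) (s n : nat) (x : 'rV[R]_n) :
    decomposition n :=
  [ffun l => Ordinal
     (card_class_subproof (fun k : 'I_n => x 0 k \in letter_class g s l))].

Definition hwu_set (R : finComUnitRingType) (g : R) (s n : nat) :
    {set decomposition n} :=
  [set hwu g s x | x : 'rV[R]_n].

Definition hwu_enum (R : finComUnitRingType) (g : R) (s n : nat)
    (pi : decomposition n) (C : {set 'rV[R]_n}) : nat :=
  #|[set c in C | hwu g s c == pi]|.

(* The entries of such an array are bounded by its row sums, hence by [n]. *)
Definition hcomp (n : nat) (pi rho : decomposition n) :
    {set {ffun letter -> decomposition n}} :=
  [set t : {ffun letter -> decomposition n} |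
     [forall i, (\sum_j t i j)%N == pi i :> nat]
  && [forall j, (\sum_i t i j)%N == rho j :> nat]].

(* The quotient is exact as soon as the [k j] sum to [m]. *)
Definition multinomial (m : nat) (k : letter -> nat) : nat :=
  (m`! %/ \prod_(j : letter) (k j)`!)%N.

Definition kappa_hom (q s n : nat)
    (t : {ffun letter -> decomposition n}) : rat :=
  (-1) ^+ t LU LS
  * (- (q%:R ^+ s.-1)) ^+ t LS LU
  * (q%:R ^+ s.-1 * (q%:R - 1)) ^+ t LZ LU
  * (q%:R ^+ s.-1 - q%:R) ^+ (t LZ LR + t LS LR)%N
  * (q%:R - 1) ^+ (t LZ LS + t LS LS + t LR LS)%N
  * (- q%:R) ^+ t LR LR.

Definition K_hom (q s n : nat) (pi rho : decomposition n) : rat :=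
  \sum_(t in hcomp pi rho | [&& t LU LU == 0 :> nat, t LU LR == 0 :> nat
                              & t LR LU == 0 :> nat])
     (\prod_(i : letter) multinomial (pi i) (fun j => t i j))%N%:R
     * kappa_hom q s t.

(* Main.v *)
Require Import Defs.
From HB Require Import structures.
From mathcomp Require Import all_boot all_order all_algebra.
From mathcomp Require Import ring.
From mathcomp Require Import all_fingroup all_field all_character.

Set Implicit Arguments.
Unset Strict Implicit.
Unset Printing Implicit Defensive.

Import GRing.Theory.
Local Open Scope ring_scope.

(** This is the MacWilliams argument by additive characters.

    Write [P k] for the ideal generated by [g ^+ k].  In a finite chain ring
    every nonzero ideal contains the socle [P s.-1] ([socle_sub]), so a
    character [chi] of [(R, +)] that is nontrivial on one socle element
    ([separating_character]) is nontrivial on every nonzero ideal.  Evaluate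
    the sum of [chi (c . y)] over [c] in [C] and [y] of decomposition [rho] in
    two ways.

    Summing over [c] first, the values [c . y] form an ideal, so the inner sum
    is [#|C|] if [y] is in the dual code and [0] otherwise ([sum_code]); the
    total is [#|C|] times the number sought.

    Summing over [y] first, choose the word of letters of [y], then the entries
    of [y] inside the chosen classes.  The sum factors over the positions, and
    a position where [c] has letter [i] and [y] has letter [j] contributes the
    sum of [chi (x * a)] over the class of [j], [x] being the entry of [c].
    Each class is a difference of ideals among [R], [P 1], [P s.-1] and [0], and
    the sum over an ideal [P k] is its cardinality or [0] according to whether
    [x * g ^+ k] vanishes; hence the contribution depends on [x] only through
    its letter ([sum_letter_class]).  Grouping words by their table of joint
    letter counts with [c] turns the sum into [K_hom] ([K_hom_words]): a product
    of multinomials counts the words with a given table ([card_word_table]), and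
    the three entries [LU LU], [LU LR], [LR LU] whose contribution is [0] give the
    restriction on the tables. *)

(** * Counting words with a prescribed table of joint letter counts *)

Lemma card_ordS_pred n (P : pred 'I_n.+1) :
  #|[set k | P k]| = (P ord0 + #|[set k | P (lift ord0 k)]|)%N.
Proof.
rewrite -!sum1dep_card big_mkcond big_ord_recl /= [in RHS]big_mkcond /=.
by case: (P ord0).
Qed.

Definition ffun_cons (J : finType) n (c : J * {ffun 'I_n -> J}) :
    {ffun 'I_n.+1 -> J} :=
  [ffun k => if unlift ord0 k is Some k' then c.2 k' else c.1].

Lemma ffun_cons0 (J : finType) n (c : J * {ffun 'I_n -> J}) :
  ffun_cons c ord0 = c.1.
Proof. by rewrite ffunE unlift_none. Qed.

Lemma ffun_consS (J : finType) n (c : J * {ffun 'I_n -> J}) k :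
  ffun_cons c (lift ord0 k) = c.2 k.
Proof. by rewrite ffunE liftK. Qed.

Lemma ffun_cons_bij (J : finType) n : bijective (@ffun_cons J n).
Proof.
exists (fun w : {ffun 'I_n.+1 -> J} => (w ord0, [ffun k => w (lift ord0 k)])).
  by case=> j w; rewrite ffun_cons0; congr (_, _); apply/ffunP=> k;
     rewrite ffunE ffun_consS.
move=> w; apply/ffunP=> k; case: (unliftP ord0 k) => [k' ->|->].
  by rewrite ffun_consS ffunE.
by rewrite ffun_cons0.
Qed.

(** Read [v] from the head: a first letter [j] facing [i = v ord0] leaves the
    table with its entry [(i, j)] decremented, which divides the product of
    factorials by [t (i, j)].  Summed over [j], these factors give the row sum,
    which is exactly what the product of the row factorials gains.  The product
    form avoids dividing at each step. *)
Lemma card_words (I J : finType) n (v : 'I_n -> I) (t : I * J -> nat) :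
  (forall i, \sum_j t (i, j) = #|[set k | v k == i]|)%N ->
  (#|[set w : {ffun 'I_n -> J} |
      [forall p, #|[set k | (v k, w k) == p]| == t p]]| * \prod_p (t p)`!
   = \prod_i #|[set k | v k == i]|`!)%N.
Proof.
elim: n v t => [|n IHn] v t row.
  have v0 i : #|[set k | v k == i]| = 0%N by apply: eq_card0 => -[].
  have t0 p : t p = 0%N.
    case: p => i j; apply/eqP; rewrite -leqn0.
    by rewrite -(v0 i) -row (bigD1 j) //= leq_addr.
  rewrite !big1 => [|i _|p _]; rewrite ?v0 ?t0 // muln1.
  have -> : [set w : {ffun 'I_0 -> J} |
      [forall p, #|[set k | (v k, w k) == p]| == t p]] = setT.
    apply/setP=> w; rewrite !inE; apply/forallP=> p.
    by rewrite t0; apply/eqP/eq_card0 => -[].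
  by rewrite cardsT card_ffun card_ord expn0.
pose v' k := v (lift ord0 k); pose i0 := v ord0.
rewrite -sum1dep_card (reindex _ (onW_bij _ (@ffun_cons_bij J n))) /=.
rewrite big_mkcond -(pair_bigA _ (fun j w =>
  if [forall p, #|[set k | (v k, ffun_cons (j, w) k) == p]| == t p]
  then 1 else 0)%N) /= big_distrl /=.
have rowS i : (\sum_j t (i, j) = (i0 == i) + #|[set k | v' k == i]|)%N.
  by rewrite row card_ordS_pred.
rewrite (eq_bigr (fun j => t (i0, j) * \prod_i #|[set k | v' k == i]|`!)%N).
  rewrite -big_distrl /= rowS eqxx add1n (bigD1 i0) //= [in RHS](bigD1 i0) //=.
  rewrite card_ordS_pred -/i0 eqxx [(true + _)%N]add1n factS -mulnA; congr (_ * (_ * _))%N.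
  apply: eq_bigr => i /negbTE ni; rewrite card_ordS_pred.
  by rewrite -/i0 (eq_sym i0) ni.
move=> j _; rewrite -big_mkcond sum1dep_card.
have split_count w p : #|[set k | (v k, ffun_cons (j, w) k) == p]|
    = (((i0, j) == p) + #|[set k | (v' k, w k) == p]|)%N.
  rewrite card_ordS_pred ffun_cons0 /=; congr (_ + _)%N; apply: eq_card => k.
  by rewrite !inE ffun_consS.
(* No word starts with [j] if the entry [(i0, j)] is zero. *)
have [t0|t_gt0] := posnP (t (i0, j)).
  rewrite t0 mul0n (_ : #|_| = 0%N) ?mul0n //.
  apply: eq_card0 => w; rewrite inE; apply/negP => /forallP/(_ (i0, j)).
  by rewrite split_count eqxx t0.
pose t' p := (t p - ((i0, j) == p))%N.
have tE p : t p = (((i0, j) == p) + t' p)%N.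
  rewrite /t'; case: eqP => [<-|_]; last by rewrite subn0.
  by rewrite subnKC.
have tF : ((t (i0, j))`! = t (i0, j) * (t' (i0, j))`!)%N.
  by rewrite tE eqxx add1n factS.
rewrite (bigD1 (i0, j)) //= tF -mulnA mulnCA; congr muln.
rewrite -(IHn v' t'); last first.
  move=> i; apply/eqP; rewrite -(eqn_add2l (i0 == i)) -rowS.
  rewrite (eq_bigr _ (fun j _ => tE (i, j))) big_split /= eqn_add2r.
  rewrite (bigD1 j) //= big1 ?addn0 => [|j' nj]; first by rewrite xpair_eqE eqxx andbT.
  by rewrite xpair_eqE (eq_sym j) (negbTE nj) andbF.
rewrite [in RHS](bigD1 (i0, j)) //=; congr muln.
  apply: eq_card => w; rewrite !inE; apply: eq_forallb => p.
  by rewrite split_count tE eqn_add2l.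
congr muln; apply: eq_bigr => p np.
by rewrite tE eq_sym (negbTE np).
Qed.

(** The quotient is the number of words with letter counts [k]; this is the
    one-row case of [card_words]. *)
Lemma prodn_fact_dvd (J : finType) (k : J -> nat) :
  (\prod_j (k j)`! %| (\sum_j k j)`!)%N.
Proof.
set m := (\sum_j k j)%N.
have card_m (i : 'I_1) : #|[set a : 'I_m | ord0 == i]| = m.
  by rewrite -[RHS]card_ord; apply: eq_card => a; rewrite !inE (ord1 i).
have row (i : 'I_1) : (\sum_j k (i, j).2)%N = #|[set a : 'I_m | ord0 == i]|.
  by rewrite card_m.
have := card_words (t := fun p => k p.2) row.
rewrite -(pair_bigA _ (fun (_ : 'I_1) j => (k j)`!)) /= !big_ord1 card_m.
by move=> <-; apply: dvdn_mull.
Qed.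

Definition word_count n (w : 'I_n -> letter) : decomposition n :=
  [ffun l => Ordinal (card_class_subproof (fun k => w k == l))].

Definition word_table n (v w : 'I_n -> letter) :
    {ffun letter -> decomposition n} :=
  [ffun i => [ffun j =>
     Ordinal (card_class_subproof (fun k => (v k, w k) == (i, j)))]].

Lemma word_countE n (w : 'I_n -> letter) l :
  word_count w l = #|[set k | w k == l]| :> nat.
Proof. by rewrite ffunE. Qed.

Lemma word_tableE n (v w : 'I_n -> letter) i j :
  word_table v w i j = #|[set k | (v k, w k) == (i, j)]| :> nat.
Proof. by rewrite !ffunE. Qed.

Lemma word_table_row n (v w : 'I_n -> letter) i :
  (\sum_j word_table v w i j = word_count v i)%N.
Proof.
rewrite word_countE -sum1dep_card (partition_big w predT) //=.
by apply: eq_bigr => j _; rewrite word_tableE -sum1dep_card.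
Qed.

Lemma word_table_col n (v w : 'I_n -> letter) j :
  (\sum_i word_table v w i j = word_count w j)%N.
Proof.
rewrite word_countE -sum1dep_card (partition_big v predT) //=.
apply: eq_bigr => i _; rewrite word_tableE -sum1dep_card.
by apply: eq_bigl => k; rewrite xpair_eqE andbC.
Qed.

Lemma card_word_table n (v : 'I_n -> letter)
    (t : {ffun letter -> decomposition n}) :
  (forall i, \sum_j t i j = word_count v i)%N ->
  #|[set w : {ffun 'I_n -> letter} | word_table v w == t]|
  = (\prod_i multinomial (word_count v i) (fun j => t i j))%N.
Proof.
move=> row; pose t2 (p : letter * letter) : nat := t p.1 p.2.
have row2 i : (\sum_j t2 (i, j) = #|[set k | v k == i]|)%N.
  by rewrite row word_countE.
have fact_gt : (0 < \prod_p (t2 p)`!)%N by apply: prodn_gt0 => p; apply: fact_gt0.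
apply/eqP; rewrite -(eqn_pmul2r fact_gt); apply/eqP.
have -> : [set w : {ffun 'I_n -> letter} | word_table v w == t]
    = [set w : {ffun 'I_n -> letter} |
         [forall p, #|[set k | (v k, w k) == p]| == t2 p]].
  apply/setP=> w; rewrite !inE; apply/eqP/forallP => [tw [i j]|tw].
    by rewrite /t2 -tw word_tableE.
  apply/ffunP=> i; apply/ffunP=> j; apply/val_inj; rewrite /= word_tableE.
  exact: (eqP (tw (i, j))).
rewrite card_words // -(pair_bigA _ (fun i j => (t i j)`!)) -big_split /=.
apply: eq_bigr => i _; rewrite /multinomial divnK ?word_countE //.
by rewrite -row2; apply: prodn_fact_dvd.
Qed.

Lemma prod_word_table (F : comNzRingType) n (v w : 'I_n -> letter)
    (M : letter -> letter -> F) :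
  \prod_k M (v k) (w k) = \prod_i \prod_j M i j ^+ word_table v w i j.
Proof.
rewrite (partition_big (fun k => (v k, w k)) predT) //=.
rewrite (pair_bigA _ (fun i j => M i j ^+ word_table v w i j)) /=.
apply: eq_bigr => -[i j] _; rewrite word_tableE /= -prodr_const.
by apply: eq_big => [k|k /eqP[-> ->]]; rewrite ?inE.
Qed.

(** The table determines both the product and, through its column sums, the
    letter counts of [w]. *)
Lemma sum_words (F : comNzRingType) n (v : 'I_n -> letter)
    (rho : decomposition n) (M : letter -> letter -> F) :
  \sum_(w : {ffun 'I_n -> letter} | word_count w == rho) \prod_k M (v k) (w k)
  = \sum_(t in hcomp (word_count v) rho)
      (\prod_i multinomial (word_count v i) (fun j => t i j))%N%:R
      * \prod_i \prod_j M i j ^+ t i j.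
Proof.
rewrite (partition_big (fun w : {ffun _} => word_table v w)
           (fun t => t \in hcomp (word_count v) rho)) /=; last first.
  move=> w /eqP cw; rewrite inE; apply/andP; split; apply/forallP => l.
    by rewrite word_table_row.
  by rewrite word_table_col cw.
apply: eq_bigr => t; rewrite inE => /andP[/forallP row /forallP col].
rewrite -card_word_table => [|i]; last exact/eqP.
rewrite -sum1dep_card natr_sum mulr_suml.
apply: eq_big => [w|w /andP[_ /eqP <-]]; last by rewrite mul1r prod_word_table.
rewrite andbC; case: eqP => //= tw; apply/eqP/ffunP => j; apply/val_inj => /=.
by rewrite -(word_table_col v) tw; apply/eqP.
Qed.

(** * The transform of the homogeneous weight-unit classes *)

Lemma big_letter (F : comNzRingType) (f : letter -> F) :
  \prod_l f l = f LZ * f LU * f LS * f LR.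
Proof.
rewrite (bigD1 LZ) // (bigD1 LU) // (bigD1 LS) // (bigD1 LR) //= big_pred0.
  by rewrite mulr1 !mulrA.
by case.
Qed.

(** The sum of [chi (x * a)] over the letter class of [j], when [x] has letter
    [i]; see [sum_letter_class]. *)
Definition hom_kernel (q s : nat) (i j : letter) : rat :=
  match j, i with
  | LZ, _ => 1
  | LU, LZ => q%:R ^+ s.-1 * (q%:R - 1)
  | LU, LS => - (q%:R ^+ s.-1)
  | LU, _ => 0
  | LS, LU => -1
  | LS, _ => q%:R - 1
  | LR, LU => 0
  | LR, LR => - q%:R
  | LR, _ => q%:R ^+ s.-1 - q%:R
  end.

Lemma prod_hom_kernel q s n (t : {ffun letter -> decomposition n}) :
  \prod_i \prod_j hom_kernel q s i j ^+ t i j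
  = if [&& t LU LU == 0 :> nat, t LU LR == 0 :> nat & t LR LU == 0 :> nat]
    then kappa_hom q s t else 0.
Proof.
rewrite !big_letter /= !expr1n !expr0n /kappa_hom !exprD.
case: eqP => _; last by rewrite !(mul0r, mulr0).
case: eqP => _; last by rewrite !(mul0r, mulr0).
case: eqP => _; last by rewrite !(mul0r, mulr0).
by rewrite /= !mul1r ?mulr1; ring.
Qed.

Lemma K_hom_words q s n (v : 'I_n -> letter) (rho : decomposition n) :
  \sum_(w : {ffun 'I_n -> letter} | word_count w == rho)
     \prod_k hom_kernel q s (v k) (w k)
  = K_hom q s (word_count v) rho.
Proof.
rewrite sum_words /K_hom big_mkcondr; apply: eq_bigr => t _.
by rewrite prod_hom_kernel; case: ifP; rewrite ?mulr0.
Qed.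

(** * Additive characters *)

(** The irreducible characters of an abelian group are linear and their kernels
    intersect trivially. *)
Lemma separating_character (V : finZmodType) (e : V) : e != 0 ->
  exists chi : V -> algC,
    [/\ chi 0 = 1, {morph chi : x y / x + y >-> x * y} & chi e != 1].
Proof.
move=> ne0; pose G := [set: V]%G.
have linG (i : Iirr G) : 'chi_i \is a linear_char.
  exact: (char_abelianP G (FinRing.zmod_abelian _)).
have : e \notin \bigcap_i cfker 'chi[G]_i by rewrite TI_cfker_irr inE.
case: (boolP [exists i : Iirr G, 'chi_i e != 1]) => [/existsP[i ei] _|].
  exists 'chi_i; split=> // [|x y]; first exact: lin_char1.
  by rewrite -FinRing.zmodMgE lin_charM ?inE.
move/existsPn => triv /bigcapP[i _]; rewrite cfkerEirr inE lin_char1 //.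
by have := triv i; rewrite negbK.
Qed.

(** Translation by [a0] preserves the sum and multiplies it by [f a0]. *)
Lemma character_sum_eq0 (V : finZmodType) (A : {set V}) (f : V -> algC) a0 :
    {morph f : a b / a + b >-> a * b} ->
    (forall a, (a0 + a \in A) = (a \in A)) -> f a0 != 1 ->
  \sum_(a in A) f a = 0.
Proof.
move=> fD stableA f1; apply/eqP.
have: \sum_(a in A) f a = f a0 * \sum_(a in A) f a.
  rewrite [LHS](reindex_inj (addrI a0)) mulr_sumr /=.
  by apply: eq_big => [a|a _]; rewrite ?stableA ?fD.
move/eqP; rewrite -subr_eq0 -{1}[\sum_(a in A) _]mul1r -mulrBl mulf_eq0.
by rewrite subr_eq0 eq_sym (negbTE f1).
Qed.

(** * Ideals of a finite chain ring *)

(** Each fibre of [f] on [A] is a translate of [K]. *)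
Lemma card_fibres (V : finZmodType) (T : finType) (f : V -> T) (A K : {set V}) :
    {in A &, forall x y, (f x == f y) = (y - x \in K)} ->
    {in A & K, forall x k, x + k \in A} ->
  #|A| = (#|f @: A| * #|K|)%N.
Proof.
move=> fK AK; rewrite -[LHS]sum1_card (partition_big_imset f) /=.
rewrite -sum_nat_const; apply: eq_bigr => _ /imsetP[x Ax ->].
rewrite sum1dep_card -(card_imset K (addrI x)); apply: eq_card => y.
rewrite inE; apply/andP/imsetP => [[Ay fy]|[k Kk ->]].
  by exists (y - x); [rewrite -fK // eq_sym | rewrite addrC subrK].
have Axk : x + k \in A by apply: AK.
by rewrite eq_sym fK // addrAC subrr add0r.
Qed.

Lemma principalP (R : finComNzRingType) (x y : R) :
  reflect (exists a, y = a * x) (y \in principal x).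
Proof.
by apply: (iffP imsetP) => [[a _ ->]|[a ->]]; exists a.
Qed.

Lemma principal0 (R : finComNzRingType) (x : R) : 0 \in principal x.
Proof. by apply/principalP; exists 0; rewrite mul0r. Qed.

Lemma principalD (R : finComNzRingType) (x : R) :
  {in principal x &, forall y z, y + z \in principal x}.
Proof.
move=> _ _ /principalP[b ->] /principalP[c ->]; apply/principalP.
by exists (b + c); rewrite mulrDl.
Qed.

Lemma principalB (R : finComNzRingType) (x : R) :
  {in principal x &, forall y z, y - z \in principal x}.
Proof.
move=> _ _ /principalP[b ->] /principalP[c ->]; apply/principalP.
by exists (b - c); rewrite mulrBl.
Qed.

(** The hypothesis is carried by the name so that properness of the ideal, and
    hence its ideal structure, can be inferred. *)
Definition nonunit_ideal (R : finComUnitRingType) (x : R)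
    (hx : x \isn't a GRing.unit) : pred R := fun y => y \in principal x.

Lemma nonunit_ideal_closed (R : finComUnitRingType) (x : R)
  (hx : x \isn't a GRing.unit) : idealr_closed (nonunit_ideal hx).
Proof.
split=> [||a _ _ /principalP[b ->] /principalP[c ->]]; apply/principalP.
- by exists 0; rewrite mul0r.
- by case=> a ax1; case/negP: hx; apply/unitrP; exists a; rewrite (mulrC x).
- by exists (a * b + c); rewrite mulrDl mulrA.
Qed.

HB.instance Definition _ (R : finComUnitRingType) (x : R)
    (hx : x \isn't a GRing.unit) :=
  isIdealr.Build R (nonunit_ideal hx) (nonunit_ideal_closed hx).

Section ChainRing.

Variables (R : finComUnitRingType) (m : idealr R) (g : R) (q s : nat).
Hypotheses (hR : chain_ring R) (hm : maximal_ideal m).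
Hypothesis mE : m =i principal g.
Hypothesis hres : #|{: residue_ring m}| = q.
Hypotheses (hnil : nilpotency_index g s) (hs : (1 < s)%N).

Local Notation P k := (principal (g ^+ k)).

Let sE : s.-1.+1 = s. Proof. by rewrite prednK // ltnW. Qed.

(** For a nonunit [x], the ideal generated by [x] is comparable with [m], and
    maximality of [m] then puts it inside [m]. *)
Lemma mem_maximal x : (x \in principal g) = (x \isn't a GRing.unit).
Proof.
rewrite -mE; apply/idP/idP => [mx|nux].
  apply/negP => ux; have := idealr1 m.
  by rewrite -(mulVr ux) idealMr.
have xx : x \in nonunit_ideal nux by apply/principalP; exists 1; rewrite mul1r.
case: (hR m (nonunit_ideal nux)) => [mx|]; last exact.
exact: (hm mx).
Qed.

Lemma nilpotent_pow_eq0 k : (g ^+ k == 0) = (s <= k)%N.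
Proof.
case: hnil => gs gk; apply/eqP/idP => [gk0|sk].
  by rewrite leqNgt; apply/negP => /gk.
by rewrite -(subnKC sk) exprD gs mul0r.
Qed.

(** Divide [x] by [g] as long as the cofactor is a nonunit; nilpotency of [g]
    stops the process before the exponent [s]. *)
Lemma unit_pow_factor x : x != 0 ->
  exists k u, [/\ (k < s)%N, u \is a GRing.unit & x = u * g ^+ k].
Proof.
move=> nx0.
have H n : (exists k u, [/\ (k < n)%N, u \is a GRing.unit & x = u * g ^+ k])
           \/ x \in P n.
  elim: n => [|n [[k [u [kn uu xE]]]|/principalP[a xE]]].
  - by right; apply/principalP; exists x; rewrite mulr1.
  - by left; exists k, u; split=> //; apply: ltnW.
  have [ua|nua] := boolP (a \is a GRing.unit); first by left; exists n, a.
  right; move: nua; rewrite -mem_maximal => /principalP[b ab].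
  by apply/principalP; exists b; rewrite xE ab exprS mulrA.
case: (H s) => // /principalP[a xE].
by case/eqP: nx0; rewrite xE; case: hnil => -> _; rewrite mulr0.
Qed.

Lemma mul_unit_eq0 (u x : R) : u \is a GRing.unit -> (u * x == 0) = (x == 0).
Proof.
by move=> uu; apply/eqP/eqP => [ux0|->]; rewrite ?mulr0 // -(mulKr uu x) ux0 mulr0.
Qed.

(** By [unit_pow_factor], [x] divides [g ^+ s.-1]: the socle is the least nonzero
    ideal. *)
Lemma socle_sub x : x != 0 -> {subset P s.-1 <= principal x}.
Proof.
case/unit_pow_factor=> k [u [ks uu ->]] _ /principalP[a ->].
apply/principalP; exists (a * g ^+ (s.-1 - k) / u).
by rewrite mulrA divrK // -mulrA -exprD subnK // -ltnS prednK // ltnW.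
Qed.

Lemma mul_g_eq0 x : (x * g == 0) = (x \in P s.-1).
Proof.
apply/idP/idP => [xg0|/principalP[a ->]]; last first.
  by rewrite -mulrA -exprSr sE; case: hnil => -> _; rewrite mulr0.
have [->|nx0] := eqVneq x 0; first exact: principal0.
case: (unit_pow_factor nx0) => k [u [ks uu xE]].
move: xg0; rewrite xE -mulrA -exprSr mul_unit_eq0 // nilpotent_pow_eq0 => sk.
have -> : k = s.-1 by apply/eqP; rewrite eqn_leq -ltnS sE ks -ltnS sE.
by apply/principalP; exists u.
Qed.

Lemma mul_socle_eq0 x : (x * g ^+ s.-1 == 0) = (x \in principal g).
Proof.
have [ux|nux] := boolP (x \is a GRing.unit).
  rewrite mul_unit_eq0 // nilpotent_pow_eq0 mem_maximal ux /=.
  by rewrite -{1}sE ltnn.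
move: (nux); rewrite -mem_maximal => mx; rewrite mx.
case/principalP: mx => a ->.
by rewrite -mulrA -exprS sE; case: hnil => -> _; rewrite mulr0 eqxx.
Qed.

Lemma principal_sub j k : (j <= k)%N -> P k \subset P j.
Proof.
move=> jk; apply/subsetP=> _ /principalP[a ->]; apply/principalP.
by exists (a * g ^+ (k - j)); rewrite -mulrA -exprD subnK.
Qed.

Lemma card_residue : #|R| = (q * #|principal g|)%N.
Proof.
rewrite -hres -[LHS]cardsT.
pose f x : residue_ring m := (\pi_({ideal_quot m})%qT x).
have -> : #|{: residue_ring m}| = #|f @: setT|.
  apply: eq_card => y; rewrite inE; apply/esym/imsetP.
  by exists (generic_quotient.repr (y : {ideal_quot m})); rewrite ?inE // /f reprK.
apply: card_fibres => x y _ _; last by rewrite inE.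
by rewrite -mE Quotient.idealrBE [RHS]eq_sym; apply/eqP/eqP.
Qed.

(** Multiplication by [g ^+ s.-1] maps [R] onto the socle with kernel the maximal
    ideal, so the socle has as many elements as the residue field. *)
Lemma card_socle : #|P s.-1| = q.
Proof.
have g0 : (0 < #|principal g|)%N.
  by apply/card_gt0P; exists 0; apply: principal0.
apply/eqP; rewrite -(eqn_pmul2r g0) -card_residue -cardsT; apply/eqP.
have -> : P s.-1 = (fun x => x * g ^+ s.-1) @: [set: R].
  by apply/setP=> y; apply/principalP/imsetP => [[a ->]|[a _ ->]]; exists a.
apply/esym/card_fibres => x y _ _; last by rewrite inE.
by rewrite -mul_socle_eq0 mulrBl subr_eq0 eq_sym.
Qed.

(** Multiplication by [g] maps [P k] onto [P k.+1], and its kernel is the socle as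
    soon as [k < s]. *)
Lemma card_principal_pow k : (k <= s)%N -> #|P k| = (q ^ (s - k))%N.
Proof.
move=> ks; rewrite -{1}(subKn ks); have := leq_subr k s.
elim: (s - k)%N => [_|j IHj js].
  rewrite subn0; case: hnil => -> _; rewrite expn0 -(cards1 (0 : R)).
  congr #|pred_of_set _|; apply/setP=> y; rewrite inE.
  apply/principalP/eqP => [[a ->]|->]; first by rewrite mulr0.
  by exists 0; rewrite mulr0.
rewrite (@card_fibres _ _ (fun x => x * g) _ (P s.-1)) => [|x y _ _|].
- rewrite card_socle expnSr -(IHj (ltnW js)); congr (#|pred_of_set _| * _)%N.
  apply/setP=> y; apply/imsetP/principalP => [[_ /principalP[a ->] ->]|[a ->]].
    by exists a; rewrite -mulrA -exprSr subnSK.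
  exists (a * g ^+ (s - j.+1)); first by apply/principalP; exists a.
  by rewrite -mulrA -exprSr subnSK.
- by rewrite -mul_g_eq0 mulrBl subr_eq0 eq_sym.
- move=> x k' Px Pk; apply: principalD => //.
  by apply: (subsetP (principal_sub _)) Pk; rewrite -ltnS sE -subSn // subSS leq_subr.
Qed.

Definition letter_of (x : R) : letter :=
  if x == 0 then LZ else if x \is a GRing.unit then LU
  else if x \in P s.-1 then LS else LR.

Lemma mem_letter_class x l : (x \in letter_class g s l) = (letter_of x == l).
Proof.
have socle_m : x \in P s.-1 -> x \in principal g.
  move=> Px; rewrite -[g]expr1; apply: (subsetP (principal_sub _)) Px.
  by rewrite -ltnS prednK // ltnW.
have P0 : 0 \in P s.-1 by apply: principal0.
rewrite /letter_of; have [->|nx0] := eqVneq x 0.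
  by case: l; rewrite !inE ?eqxx ?unitr0 ?P0.
have [ux|nux] := boolP (x \is a GRing.unit).
  have nS : x \notin P s.-1.
    by apply/negP=> /socle_m; rewrite mem_maximal ux.
  by case: l; rewrite !inE ?(negbTE nx0) ?ux ?(negbTE nS) ?mem_maximal ?ux.
have [Sx|nSx] := boolP (x \in P s.-1).
  by case: l; rewrite !inE ?(negbTE nx0) ?(negbTE nux) ?Sx.
by case: l; rewrite !inE ?(negbTE nx0) ?(negbTE nux) ?(negbTE nSx) ?mem_maximal ?nux.
Qed.

(** * Character sums over ideals, letter classes and codes *)

Variables (chi : R -> algC) (e : R).
Hypotheses (chi0 : chi 0 = 1) (chiD : {morph chi : x y / x + y >-> x * y}).
Hypotheses (socle_e : e \in P s.-1) (chi_e : chi e != 1).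

(** If [x * g ^+ k] is nonzero, the ideal [x * P k] contains [e], so the character
    [a |-> chi (x * a)] is nontrivial on [P k]. *)
Lemma sum_principal_pow x k : (k <= s)%N ->
  \sum_(a in P k) chi (x * a)
  = if x * g ^+ k == 0 then (q ^ (s - k))%:R else 0.
Proof.
move=> ks; have [xg0|nxg0] := eqVneq (x * g ^+ k) 0.
  rewrite -card_principal_pow // -sumr_const.
  apply: eq_bigr => _ /principalP[a ->].
  by rewrite mulrCA xg0 mulr0 chi0.
have /principalP[b eE] := socle_sub nxg0 socle_e.
apply: (character_sum_eq0 (a0 := b * g ^+ k)) => [y z|a|].
- by rewrite mulrDr chiD.
- have Pb : b * g ^+ k \in P k by apply/principalP; exists b.
  apply/idP/idP => Pa; last exact: principalD.
  by rewrite -[a](addKr (b * g ^+ k)) addrC principalB.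
- by rewrite mulrCA -eE.
Qed.

Lemma sum_setD (A B : {set R}) (f : R -> algC) : B \subset A ->
  \sum_(a in A :\: B) f a = \sum_(a in A) f a - \sum_(a in B) f a.
Proof.
by move=> /setIidPr BA; rewrite [in RHS](big_setID B) /= BA addrAC subrr add0r.
Qed.

(** The class of [LU] is [R] minus [P 1], that of [LS] is [P s.-1] minus [0], and
    that of [LR] is [P 1] minus [P s.-1].  The sums over [R], [P 1] and [P s.-1]
    survive when [x] is zero, in the socle, and a nonunit, respectively. *)
Lemma sum_letter_class x l :
  \sum_(a in letter_class g s l) chi (x * a)
  = ratr (hom_kernel q s (letter_of x) l).
Proof.
have s1 : (s.-1 <= s)%N by apply: leq_pred.
have S0 : \sum_(a in [set 0]) chi (x * a) = 1.
  by rewrite big_set1 mulr0 chi0.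
have SP := sum_principal_pow x.
have ST : \sum_(a in [set: R]) chi (x * a)
    = if x == 0 then (q ^ s)%:R else 0.
  have := SP 0%N isT; rewrite mulr1 subn0 => <-; apply: eq_bigl => a.
  by rewrite inE; apply/esym/principalP; exists a; rewrite mulr1.
have SM : \sum_(a in principal g) chi (x * a)
    = if x \in P s.-1 then (q ^ s.-1)%:R else 0.
  by have := SP 1%N (ltnW hs); rewrite mul_g_eq0 subn1.
have SS : \sum_(a in P s.-1) chi (x * a)
    = if x \is a GRing.unit then 0 else q%:R.
  have := SP s.-1 s1; rewrite mul_socle_eq0 mem_maximal.
  by rewrite -{2}sE subSnn expn1 => ->; case: (x \is a GRing.unit).
have P0 : 0 \in P s.-1 by apply: principal0.
have SU : \sum_(a in letter_class g s LU) chi (x * a)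
    = \sum_(a in [set: R]) chi (x * a) - \sum_(a in principal g) chi (x * a).
  rewrite -sum_setD ?subsetT //; apply: eq_bigl => a.
  by rewrite !inE mem_maximal negbK andbT.
have nS : x \is a GRing.unit -> x \in P s.-1 = false.
  move=> ux; apply/negP=> Sx; have /eqP : x * g == 0 by rewrite mul_g_eq0.
  move/eqP; rewrite mul_unit_eq0 // -[g]expr1 nilpotent_pow_eq0.
  by rewrite leqNgt hs.
have PS : P s.-1 \subset principal g.
  have : P s.-1 \subset P 1 by apply: principal_sub; rewrite -ltnS sE.
  by rewrite expr1.
have ratr_pow k : ratr (q%:R ^+ k) = q%:R ^+ k :> algC.
  by rewrite rmorphXn /= ratr_nat.
have ratr_pred : ratr (q%:R - 1) = q%:R - 1 :> algC.
  by rewrite rmorphB /= ratr_nat rmorph1.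
case: l; rewrite ?SU //= ?S0 ?ST ?SM ?sum_setD ?sub1set ?S0 ?SM ?SS //.
- by rewrite rmorph1.
- rewrite /letter_of; have [->|nx0] := eqVneq x 0.
    by rewrite P0 rmorphM /= ratr_pow ratr_pred mulrBr mulr1 -exprSr sE !natrX.
  have [ux|nux] := boolP (x \is a GRing.unit).
    by rewrite nS // subr0 rmorph0.
  case: ifP => _; last by rewrite subr0 rmorph0.
  by rewrite rmorphN /= ratr_pow sub0r natrX.
- rewrite /letter_of; have [->|nx0] := eqVneq x 0.
    by rewrite unitr0 ratr_pred.
  have [ux|nux] := boolP (x \is a GRing.unit).
    by rewrite sub0r rmorphN rmorph1.
  by case: ifP => _; rewrite ratr_pred.
- rewrite /letter_of; have [->|nx0] := eqVneq x 0.
    by rewrite unitr0 P0 rmorphB /= ratr_pow ratr_nat natrX.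
  have [ux|nux] := boolP (x \is a GRing.unit).
    by rewrite nS // subr0 rmorph0.
  case: ifP => _; first by rewrite rmorphB /= ratr_pow ratr_nat natrX.
  by rewrite sub0r rmorphN /= ratr_nat.
Qed.

Definition row_letters n (x : 'rV[R]_n) (k : 'I_n) : letter := letter_of (x 0 k).

Lemma hwuE n (x : 'rV[R]_n) : hwu g s x = word_count (row_letters x).
Proof.
apply/ffunP=> l; apply/val_inj; rewrite /= word_countE ffunE /=.
by apply: eq_card => k; rewrite !inE mem_letter_class.
Qed.

Lemma character_sum (I : finType) (f : I -> R) :
  chi (\sum_i f i) = \prod_i chi (f i).
Proof. exact: (big_morph chi chiD chi0). Qed.

(** The inner sum for a fixed codeword: the entries of [y] are chosen
    independently once the word of its letters is fixed. *)
Lemma sum_hwu n (c : 'rV[R]_n) (rho : decomposition n) :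
  \sum_(y | hwu g s y == rho) chi (\sum_k c 0 k * y 0 k)
  = ratr (K_hom q s (hwu g s c) rho).
Proof.
rewrite hwuE -K_hom_words rmorph_sum /=.
pose row_of (f : {ffun 'I_n -> R}) : 'rV[R]_n := \row_k f k.
pose word (f : {ffun 'I_n -> R}) := [ffun k => letter_of (f k)].
have row_bij : bijective row_of.
  exists (fun x : 'rV_n => [ffun k => x 0 k]) => [f|x].
    by apply/ffunP=> k; rewrite !ffunE mxE.
  by apply/rowP=> k; rewrite !mxE ffunE.
have count_word f : hwu g s (row_of f) = word_count (word f).
  rewrite hwuE; apply/ffunP=> l; apply/val_inj; rewrite /= !word_countE.
  by apply: eq_card => k; rewrite !inE /row_letters mxE ffunE.
rewrite (reindex _ (onW_bij _ row_bij)) /=.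
rewrite (partition_big word (fun w => word_count w == rho)) /=; last first.
  by move=> f; rewrite count_word.
apply: eq_bigr => w /eqP wrho; rewrite rmorph_prod /=.
under [RHS]eq_bigr => k _ do rewrite -sum_letter_class.
rewrite bigA_distr_big_dep /=; apply: eq_big => [f|f _].
  rewrite count_word; apply/andP/familyP => [[_ /eqP <-] k|fw].
    by rewrite ffunE mem_letter_class.
  suff -> : word f = w by rewrite wrho eqxx.
  by apply/ffunP=> k; apply/eqP; rewrite ffunE -mem_letter_class fw.
by rewrite character_sum //; apply: eq_bigr => k _; rewrite mxE.
Qed.

(** If some [c0] in [C] is not orthogonal to [y], a multiple [r *: c0] pairs with
    [y] to [e], and translating [C] by it multiplies the sum by [chi e]. *)
Lemma sum_code n (C : {set 'rV[R]_n}) (y : 'rV[R]_n) : linear_code C ->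
  \sum_(c in C) chi (\sum_k c 0 k * y 0 k)
  = if y \in dual C then #|C|%:R else 0.
Proof.
case=> C0 CZ; rewrite inE; case: ifPn => [/forall_inP yC|/forall_inPn[c0 Cc0 nc0]].
  rewrite -sumr_const; apply: eq_bigr => c /yC/eqP cy.
  by rewrite (eq_bigr _ (fun k _ => mulrC _ _)) cy chi0.
have /principalP[r eE] := socle_sub nc0 socle_e.
apply: (character_sum_eq0 (a0 := r *: c0)) => [a b|c|].
- rewrite -chiD -big_split; congr chi; apply: eq_bigr => k _.
  by rewrite mxE mulrDl.
- apply/idP/idP => Cc; last exact: CZ.
  rewrite -[c](addKr (r *: c0)) -scaleN1r scalerA.
  exact: CZ.
- rewrite (_ : \sum_k _ = e) // eE mulr_sumr; apply: eq_bigr => k _.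
  by rewrite mxE -mulrA (mulrC (c0 0 k)).
Qed.

End ChainRing.

Theorem corollary28 (R : finComUnitRingType) (m : idealr R) (gamma : R)
    (p r q s n : nat) (C : {set 'rV[R]_n}) (rho : decomposition n)
    (hR : chain_ring R)
    (hm : maximal_ideal m)
    (hgamma : m =i principal gamma)
    (hp : prime p)
    (hq : q = (p ^ r)%N)
    (hres : #|{: residue_ring m}| = q)
    (hnil : nilpotency_index gamma s)
    (hs : (1 < s)%N)
    (hC : linear_code C)
    (hrho : rho \in hwu_set gamma s n) :
  (hwu_enum gamma s rho (dual C))%:R
  = #|C|%:R^-1
    * (\sum_(pi in hwu_set gamma s n)
         K_hom q s pi rho * (hwu_enum gamma s pi C)%:R) :> rat.
Proof.
have nz_e : gamma ^+ s.-1 != 0.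
  by apply/eqP; case: hnil => _; apply; rewrite prednK // ltnW.
have [chi [chi0 chiD chi_e]] := separating_character nz_e.
have socle_e : gamma ^+ s.-1 \in principal (gamma ^+ s.-1).
  by apply/principalP; exists 1; rewrite mul1r.
have C_neq0 : #|C|%:R != 0 :> rat.
  by rewrite Num.Theory.pnatr_eq0 -lt0n; apply/card_gt0P; exists 0; case: hC.
apply: (mulfI C_neq0); rewrite mulVKf //.
apply: (fmorph_inj (ratr : rat -> algC)).
(* Count the pairs [(c, y)] with weight [chi (c . y)] in both orders. *)
transitivity (\sum_(c in C) \sum_(y | hwu gamma s y == rho)
                chi (\sum_k c 0 k * y 0 k)).
  rewrite exchange_big /= rmorphM !rmorph_nat /hwu_enum -sum1dep_card.
  rewrite natr_sum mulr_sumr big_mkcondl /= [RHS]big_mkcond /=.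
  rewrite big_mkcond; apply: eq_bigr => y _.
  rewrite (sum_code hR hm hgamma hnil hs chi0 chiD socle_e chi_e _ hC).
  by case: (_ == rho); case: (y \in dual C); rewrite ?mulr1.
rewrite (partition_big (@hwu R gamma s n) (mem (hwu_set gamma s n))) /=; last first.
  by move=> c _; apply: imset_f.
rewrite rmorph_sum /=; apply: eq_bigr => pi _.
rewrite rmorphM /= ratr_nat /hwu_enum -sum1dep_card natr_sum mulr_sumr.
apply: eq_bigr => c /andP[_ /eqP <-].
by rewrite (sum_hwu hR hm hgamma hres hnil hs chi0 chiD socle_e chi_e) mulr1.
Qed.
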